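(* Let $\mathbb{F}$ be a field and let $n\ge d\ge 1$ with $|\mathbb{F}|\ge n$. Then the monomial set of the elementary symmetric polynomial $S_n^d$ is expressible as a read-once determinant: there exists a matrix $M$ with entries in $\{x_1,\ldots,x_n\}\cup\mathbb{F}$, in which each variable $x_i$ occurs in at most one position, such that $mon(\det(M))=mon(S_n^d)$.
   Context: $S_n^d(x_1,\ldots,x_n)=\sum_{A\subseteq\{1,\ldots,n\},|A|=d}\prod_{i\in A}x_i$. For a polynomial $f\in\mathbb{F}[x_1,\ldots,x_n]$, $mon(f)$ denotes the set of monomials having nonzero coefficient in $f$. *)

(* Defs.v *)
From HB Require Import structures.
From mathcomp Require Import all_boot all_order all_algebra.
From mathcomp Require Export mpoly.

Set Implicit Arguments.
Unset Strict Implicit.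
Unset Printing Implicit Defensive.

Import GRing.Theory.
Local Open Scope ring_scope.

(* Cardinality of a possibly infinite type: T has at least n elements. *)
Definition card_at_least (T : Type) (n : nat) : Prop :=
  exists f : 'I_n -> T, injective f.

Definition var_or_const_entries (F : fieldType) (n m : nat)
    (M : 'M[{mpoly F[n]}]_m) : Prop :=
  forall i j : 'I_m,
    (exists k : 'I_n, M i j = 'X_k) \/ (exists c : F, M i j = c%:MP).

Definition each_var_at_most_once (F : fieldType) (n m : nat)
    (M : 'M[{mpoly F[n]}]_m) : Prop :=
  forall (k : 'I_n) (i j i' j' : 'I_m),
    M i j = 'X_k -> M i' j' = 'X_k -> i = i' /\ j = j'.

(* [msupp] is a duplicate-free list of the monomials with nonzero coefficient;
   [=i] compares these lists as sets. *)
Definition mon_read_once_det (F : fieldType) (n : nat)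
    (f : {mpoly F[n]}) : Prop :=
  exists (m : nat) (M : 'M[{mpoly F[n]}]_m),
    [/\ var_or_const_entries M,
        each_var_at_most_once M
      & msupp (\det M) =i msupp f].

(* Main.v *)
(** With k = n - d and distinct scalars a_1, ..., a_n, let V be the n x k
    Vandermonde matrix (a_i^j). The determinant of [[diag(x), V], [V^T, 0]] is
    multilinear in its first n rows, so the coefficient of prod_(i in T) x_i is
    the determinant of the matrix where row i of [diag(x), V] is replaced by the
    unit vector e_i for i in T, and by (0, V_i) for i not in T. That constant
    matrix is singular unless exactly k rows remain in V, i.e. |T| = d, and then
    it is invertible because k x k Vandermonde matrices on distinct nodes are. *)
Require Import Defs.
From mathcomp Require Import all_boot all_order all_algebra.
From mathcomp Require Import all_fingroup.

Set Implicit Arguments.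
Unset Strict Implicit.
Unset Printing Implicit Defensive.

Import GRing.Theory.
Local Open Scope ring_scope.

Definition restrict_rows (R : nzRingType) (n k : nat) (T : {set 'I_n})
    (B : 'M[R]_(n, k)) (A : 'M[R]_(k, n)) : 'M[R]_(n + k) :=
  block_mx (diag_mx (\row_i (i \in T)%:R))
           (\matrix_(i, j) (if i \in T then 0 else B i j)) A 0.

Lemma det_block_diag_expand (R : comNzRingType) (n k : nat) (x : 'rV[R]_n)
    (B : 'M[R]_(n, k)) (A : 'M[R]_(k, n)) :
  \det (block_mx (diag_mx x) B A 0) =
  \sum_(T : {set 'I_n}) (\prod_(i in T) x 0 i) * \det (restrict_rows T B A).
Proof.
rewrite /determinant.
under [RHS]eq_bigr do rewrite mulr_sumr.
rewrite exchange_big /=; apply: eq_bigr => s _.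
rewrite big_split_ord /=.
(* In a Leibniz term, the factor from row i of the upper part splits into a diagonal contribution
   [f i] and a contribution [g i] of the block B. Distributing the product over these sums yields
   the sets T of rows where [f] is chosen. *)
pose f (i : 'I_n) := x 0 i * (s (lshift k i) == lshift k i)%:R.
pose g (i : 'I_n) := (block_mx (0 : 'M_n) B A 0) (lshift k i) (s (lshift k i)).
have rowE (i : 'I_n) :
    (block_mx (diag_mx x) B A 0) (lshift k i) (s (lshift k i)) = f i + g i.
  rewrite /f /g; case: (split_ordP (s (lshift k i))) => j ->.
    by rewrite !block_mxEul !mxE eq_lshift addr0 eq_sym mulr_natr.
  by rewrite !block_mxEur eq_rlshift mulr0 add0r.
under eq_bigr do rewrite rowE.
rewrite bigA_distr mulr_suml mulr_sumr; apply: eq_bigr => T _.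
rewrite [RHS]mulrCA big_split_ord /=; congr (_ * _).
rewrite [RHS]mulrA; congr (_ * _); last first.
  by apply: eq_bigr => j _; case: (split_ordP (s (rshift n j))) => l ->;
     rewrite /restrict_rows ?block_mxEdl ?block_mxEdr.
rewrite [X in _ = X * _]big_mkcond -big_split /=; apply: eq_bigr => i _.
rewrite /f /g /restrict_rows; case: (split_ordP (s (lshift k i))) => j ->.
  rewrite !block_mxEul !mxE eq_lshift eq_sym.
  by case: ifP; rewrite ?mul0rn ?mulr0.
rewrite !block_mxEur !mxE eq_rlshift.
by case: ifP; rewrite ?mul1r.
Qed.

(* Every permutation contributing to the determinant sends the rows outside T
   into the last k columns, and the last k columns are only reached from there. *)
Lemma det_restrict_rows0 (R : comNzRingType) (n k : nat) (T : {set 'I_n})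
    (B : 'M[R]_(n, k)) (A : 'M[R]_(k, n)) :
  #|~: T| != k -> \det (restrict_rows T B A) = 0.
Proof.
move=> cardT; apply: big1 => s _.
have [/existsP[i /eqP z]|nz] :=
  boolP [exists i, restrict_rows T B A i (s i) == 0].
  by rewrite (bigD1 i) //= z mul0r mulr0.
case/negP: cardT; move: nz; rewrite negb_exists => /forallP nz.
pose C := [set rshift n j | j in [set: 'I_k]].
have <- : #|C| = k.
  by rewrite card_imset ?cardsT ?card_ord //; apply: rshift_inj.
(* Since s is injective, an exact match between the image of the rows outside T and [C] forces equal
   cardinalities. *)
rewrite -(card_imset _ (@lshift_inj n k)) -(card_imset _ (@perm_inj _ s)).
suff -> : s @: [set lshift k i | i in ~: T] = C by [].
apply/setP/subset_eqP/andP; split; apply/subsetP => c.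
  case/imsetP=> _ /imsetP[i iT ->] ->; have := nz (lshift k i).
  case: (split_ordP (s (lshift k i))) => j -> ; last by rewrite imset_f ?inE.
  rewrite /restrict_rows block_mxEul !mxE.
  by move: iT; rewrite inE => /negbTE ->; rewrite mul0rn eqxx.
case/imsetP=> j _ ->; apply/imsetP; exists (s^-1 (rshift n j))%g; last by rewrite permKV.
have := nz (s^-1 (rshift n j))%g; rewrite permKV.
case: (split_ordP (s^-1 (rshift n j))%g) => i ->.
  rewrite /restrict_rows block_mxEur !mxE => h; apply: imset_f; rewrite inE.
  by apply: contra h => ->.
by rewrite /restrict_rows block_mxEdr mxE eqxx.
Qed.

Definition vandermonde_rows (F : fieldType) (n k : nat) (a : 'I_n -> F) :
    'M[F]_(n, k) := \matrix_(i, j) a i ^+ j.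

(** Let (r, s) be a left kernel vector and read s as a polynomial of degree less than k. The first n
    columns make it vanish at the k nodes outside T, so s = 0, and then r vanishes on T. The last k
    columns are dual: they are tested against polynomials to kill r outside T. *)
Lemma det_restrict_vandermonde (F : fieldType) (n k : nat) (a : 'I_n -> F)
    (T : {set 'I_n}) :
  injective a -> #|~: T| = k ->
  \det (restrict_rows T (vandermonde_rows k a) (vandermonde_rows k a)^T) != 0.
Proof.
move=> a_inj cardT; apply/det0P => -[v].
rewrite -(hsubmxK v); move: (lsubmx v) (rsubmx v) => r s rs_neq0.
rewrite mul_row_block mulmx0 addr0 -row_mx0 => /eq_row_mx[eqA eqB].
have evalA (i : 'I_n) : (i \in T)%:R * r 0 i + (rVpoly s).[a i] = 0.
  move/rowP/(_ i): eqA; rewrite mul_mx_diag !mxE => eqAi.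
  rewrite -[RHS]eqAi mulrC; congr (_ + _).
  rewrite horner_poly; apply: eq_bigr => j _.
  by rewrite valK !mxE.
have s0 : s = 0.
  suff p0 : rVpoly s = 0 by rewrite -(rVpolyK s) p0 linear0.
  apply/eqP/negPn/negP => p_neq0.
  have /(max_poly_roots p_neq0) : all (root (rVpoly s)) [seq a i | i in ~: T].
    apply/allP => _ /imageP[i iT ->]; rewrite inE in iT.
    by apply/eqP; have := evalA i; rewrite (negbTE iT) mul0r add0r.
  rewrite map_inj_uniq // enum_uniq size_map -cardE cardT => /(_ isT).
  by rewrite ltnNge size_poly.
have rT i : i \in T -> r 0 i = 0.
  by move=> iT; have := evalA i; rewrite iT s0 linear0 horner0 mul1r addr0.
(* The last k columns give this for the powers 1, ..., X^(k-1); linearity gives the rest. *)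
have annih (p : {poly F}) : (size p <= k)%N ->
    \sum_(i in ~: T) r 0 i * p.[a i] = 0.
  move=> szp; under eq_bigr do rewrite (horner_coef_wide _ szp) mulr_sumr.
  rewrite exchange_big big1 //= => j _.
  move/rowP/(_ j): eqB; rewrite !mxE => eqBj.
  rewrite -[RHS](mulr0 p`_j) -[X in _ = _ * X]eqBj mulr_sumr [LHS]big_mkcond /=.
  apply: eq_bigr => i _; rewrite !mxE inE.
  by case: (i \in T); rewrite /= ?mxE ?mulr0 // mulrCA.
have r0 : r = 0.
  apply/rowP => i; rewrite [RHS]mxE.
  have [iT|iT] := boolP (i \in T); first exact: rT.
  (* An unnormalised Lagrange polynomial: among the nodes outside T, only [a i] is not a root. Its k
     - 1 factors give size exactly k, the limit allowed by [annih]. *)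
  pose p := \prod_(l <- enum (~: T :\ i)) ('X - (a l)%:P).
  have iC : i \in ~: T by rewrite inE.
  have := annih p; rewrite size_prod_XsubC -cardE.
  rewrite -[in X in X -> _]cardT (cardsD1 i (~: T)) iC => /(_ (leqnn _)).
  rewrite (bigD1 i) //= big1 ?addr0 => [|l /andP[lC lni]].
    move/eqP; rewrite mulf_eq0 => /orP[/eqP //|].
    rewrite horner_prod prodf_seq_eq0 => /hasP[l].
    rewrite mem_enum !inE => /andP[lni _].
    by rewrite hornerXsubC subr_eq0 (inj_eq a_inj) eq_sym (negbTE lni).
  rewrite horner_prod (bigD1_seq l) ?enum_uniq //=; last by rewrite mem_enum in_setD1 lni.
  by rewrite hornerXsubC subrr mul0r mulr0.
by case/negP: rs_neq0; rewrite r0 s0 row_mx0.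
Qed.

Lemma mpolyC_neq_mpolyXU (R : nzRingType) (n : nat) (c : R) (k : 'I_n) :
  c%:MP <> 'X_k :> {mpoly R[n]}.
Proof.
move/(congr1 (mcoeff U_(k)%MM)); rewrite mcoeffC mcoeffXU eqxx mnm1_eq0 mulr0.
by move/esym/eqP; rewrite oner_eq0.
Qed.

Lemma mpolyXU_inj (R : nzRingType) (n : nat) :
  injective (fun k : 'I_n => 'X_k : {mpoly R[n]}).
Proof.
move=> k l /(congr1 (mcoeff U_(l)%MM)); rewrite !mcoeffXU eqxx.
by case: eqP => // _ /esym/eqP; rewrite oner_eq0.
Qed.

Definition read_once_mx (F : fieldType) (n k : nat) (a : 'I_n -> F) :
    'M[{mpoly F[n]}]_(n + k) :=
  block_mx (diag_mx (\row_i 'X_i))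
           (map_mx (@mpolyC n F) (vandermonde_rows k a))
           (map_mx (@mpolyC n F) (vandermonde_rows k a)^T) 0.

Lemma read_once_mxP (F : fieldType) (n k : nat) (a : 'I_n -> F) i j :
  (exists2 l : 'I_n, i = lshift k l /\ j = lshift k l
      & read_once_mx k a i j = 'X_l)
  \/ (exists c : F, read_once_mx k a i j = c%:MP).
Proof.
rewrite /read_once_mx.
case: (split_ordP i) => i' ->; case: (split_ordP j) => j' ->.
- rewrite block_mxEul !mxE; have [<-|_] := eqVneq i' j'.
    by left; exists i'.
  by right; exists 0; rewrite mulr0n mpolyC0.
- by rewrite block_mxEur mxE; right; eexists.
- by rewrite block_mxEdl mxE; right; eexists.
- by rewrite block_mxEdr mxE; right; exists 0; rewrite mpolyC0.
Qed.

Lemma det_read_once_mx (F : fieldType) (n k : nat) (a : 'I_n -> F) :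
  \det (read_once_mx k a) =
  \sum_(T : {set 'I_n})
     \det (restrict_rows T (vandermonde_rows k a) (vandermonde_rows k a)^T)
       *: 'X_[mesym1 T].
Proof.
rewrite det_block_diag_expand; apply: eq_bigr => T _.
rewrite -mul_mpolyC mulrC; congr (_ * _).
  (* The restricted matrix over the polynomial ring is the entrywise image of the one over F, so its
     determinant is a constant. *)
  rewrite -det_map_mx /restrict_rows map_block_mx map_mx0; congr (\det (block_mx _ _ _ _)).
    by apply/matrixP => i j; rewrite !mxE rmorphMn rmorph_nat.
  by apply/matrixP => i j; rewrite !mxE; case: ifP; rewrite ?rmorph0.
rewrite mpolyXE_id big_mkcond; apply: eq_bigr => i _.
by rewrite mxE mnmE; case: (i \in T).
Qed.

Local Close Scope ring_scope.

Theorem theorem3 (F : fieldType) (n d : nat) (hd : 1 <= d) (hdn : d <= n)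
    (hF : card_at_least F n) :
  mon_read_once_det (mesym n F d).
Proof.
case: hF => a a_inj; exists (n + (n - d))%N, (read_once_mx (n - d) a); split.
- by move=> i j; case: (read_once_mxP a i j) => [[l _ ->]|]; [left; exists l | right].
- move=> l i j i' j'.
  case: (read_once_mxP a i j) => [[u [-> ->] ->]|[c ->] /mpolyC_neq_mpolyXU //].
  move/mpolyXU_inj ->.
  case: (read_once_mxP a i' j') => [[w [-> ->] ->]|[c ->] /mpolyC_neq_mpolyXU //].
  by move/mpolyXU_inj ->.
move=> m; rewrite msupp_mesymP mcoeff_msupp det_read_once_mx raddf_sum /=.
under eq_bigr do rewrite mcoeffZ mcoeffX.
apply/idP/existsP => [nz|[T /andP[/eqP cardT /eqP ->]]].
  have [T /andP[cardT mT]|none] :=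
    pickP (fun T : {set 'I_n} => (#|~: T| == n - d)%N && (mesym1 T == m)).
    (* As d <= n, the subtraction is not truncated, and a complement of size n - d means that T has
       size d. *)
    exists T; rewrite (eqP mT) eqxx andbT -(eqn_add2r (n - d)) subnKC //.
    by rewrite -(eqP cardT) cardsC card_ord.
  case/negP: nz; rewrite big1 // => T _.
  move: (none T); have [cardT /= ->|cardT _] := eqVneq; first by rewrite mulr0.
  by rewrite det_restrict_rows0 ?mul0r.
(* Distinct sets give distinct monomials, so T alone contributes to this coefficient and nothing
   cancels. *)
rewrite (bigD1 T) //= eqxx mulr1 big1 ?addr0 => [|U UT].
  apply: det_restrict_vandermonde => //.
  by rewrite cardsCs setCK cardT card_ord.
by rewrite (inj_eq (@inj_mesym1 n)) (negbTE UT) mulr0.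
Qed.
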